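(* Let $X$ be a smooth Banach space over $\mathbb{C}$ and let $T\in B(X)$ be self-adjoint. Let $x_1$ and $x_2$ be eigenvectors of $T$ corresponding to two distinct eigenvalues of $T$. Then $x_2\in {}^\perp J(x_1)$ and $x_1\in {}^\perp J(x_2)$.
   Context: $B(X)$ is the space of bounded linear operators on $X$, $S_X=\{x\in X:\|x\|=1\}$, $X^*$ is the space of bounded linear functionals on $X$. $X$ is smooth if every $x\in S_X$ admits a unique $x^*\in S_{X^*}$ with $x^*(x)=1$. The duality mapping $J:X\to X^*$ of a smooth Banach space assigns to each $x$ the unique functional $J(x)$ with $\|J(x)\|=\|x\|$ and $J(x)(x)=\|x\|^2$. For $x\in X$, ${}^\perp J(x)=\{y\in X: J(x)(y)=0\}$. For $T\in B(X)$ the transpose $T':X^*\to X^*$ is $(T'f)(x)=f(Tx)$. $T\in B(X)$ is self-adjoint if $T'\circ J=J\circ T$. *)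

(* Defs.v *)
From HB Require Import structures.
From mathcomp Require Import all_boot all_order all_algebra.
From mathcomp Require Import complex.
From mathcomp Require Import all_classical all_reals all_analysis.

Set Implicit Arguments.
Unset Strict Implicit.
Unset Printing Implicit Defensive.

Import Order.TTheory GRing.Theory Num.Theory.
Import numFieldNormedType.Exports.

Local Open Scope classical_set_scope.
Local Open Scope ring_scope.
Local Open Scope complex_scope.

(* By linear_boundedP, being bounded near 0 amounts to `|f x| <= r * `|x| for
   all x and all large enough r. *)
Record boundedLinear (K : numFieldType) (V W : normedModType K) := BoundedLinear {
  bl_fun :> {linear V -> W};
  bl_bounded : bounded_near bl_fun (nbhs 0) }.

Section BoundedLinearTheory.
Context {K : numFieldType}.
Implicit Types U V W : normedModType K.

Lemma bl_eq V W (f g : boundedLinear V W) : (forall x, f x = g x) -> f = g.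
Proof.
case: f g => [f bf] [g bg] /= fg.
have efg : f = g.
  case: f g fg {bf bg} => f [[pf] [qf]] [g [[pg] [qg]]] /= /funext e.
  by subst g; rewrite (Prop_irrelevance pf pg) (Prop_irrelevance qf qg).
by subst g; rewrite (Prop_irrelevance bf bg).
Qed.

Lemma bl_zero_bounded V W : bounded_near (\0 : {linear V -> W}) (nbhs 0).
Proof. by apply/linear_bounded_continuous; exact: cst_continuous. Qed.

Definition bl_zero V W := BoundedLinear (@bl_zero_bounded V W).

Lemma bl_comp_bounded U V W (g : boundedLinear V W) (f : boundedLinear U V) :
  bounded_near (bl_fun g \o bl_fun f : {linear U -> W}) (nbhs 0).
Proof.
apply/linear_bounded_continuous => x; apply: continuous_comp.
- exact: (linear_bounded_continuous f).1 (bl_bounded f) x.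
- exact: (linear_bounded_continuous g).1 (bl_bounded g) _.
Qed.

Lemma bl_scale_bounded V W (c : K) (f : boundedLinear V W) :
  bounded_near (c \*: bl_fun f : {linear V -> W}) (nbhs 0).
Proof.
apply/linear_bounded_continuous => x; apply: continuousZr.
exact: (linear_bounded_continuous f).1 (bl_bounded f) x.
Qed.

Definition bl_scale V W (c : K) (f : boundedLinear V W) :=
  BoundedLinear (bl_scale_bounded c f).

Definition bl_comp U V W (g : boundedLinear V W) (f : boundedLinear U V) :=
  BoundedLinear (bl_comp_bounded g f).

HB.instance Definition _ V W := gen_eqMixin (boundedLinear V W).
HB.instance Definition _ V W := gen_choiceMixin (boundedLinear V W).
HB.instance Definition _ V W := isPointed.Build (boundedLinear V W) (bl_zero V W).

End BoundedLinearTheory.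

Section Duality.
Context {R : realType} {X : completeNormedModType R[i]}.

Definition bounded_operators := boundedLinear X X.

Definition dual_space := boundedLinear X R[i]^o.

Implicit Types f g : dual_space.

(* Norms take values in R[i], on which the order is partial; the supremum is
   therefore taken in R and embedded back in R[i]. *)
Definition dual_norm f : R[i] :=
  (sup [set r : R | exists2 x : X, `|x| <= 1 & `|f x| = r%:C])%:C.

Definition smooth : Prop :=
  forall x : X, `|x| = 1 ->
    exists! f : dual_space, dual_norm f = 1 /\ f x = 1.

Definition dual_spec (x : X) f : Prop :=
  dual_norm f = `|x| /\ f x = `|x| ^+ 2.

Let normS f := [set r : R | exists2 x : X, `|x| <= 1 & `|f x| = r%:C].

Let normS_has_sup f : has_sup (normS f).
Proof.
split; first by exists 0, 0; rewrite ?normr0 ?ler01 // linear0 normr0.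
have /bounded_funP/(_ 1)[M fM] := bl_bounded f.
exists (complex.Re M) => r [x x1 fx]; have := fM x x1.
by rewrite fx lecE /= => /andP[].
Qed.

Lemma norm_le_dual_norm f (x : X) : `|f x| <= dual_norm f * `|x|.
Proof.
have [->|x0] := eqVneq x 0; first by rewrite linear0 !normr0 mulr0.
have nx0 : 0 < `|x| by rewrite normr_gt0.
have <- : `|x| * `|f (`|x|^-1 *: x)| = `|f x|.
  by rewrite linearZ /= normrZ normfV normr_id mulVKf // gt_eqF.
rewrite mulrC ler_pM2r //.
have e : `|f (`|x|^-1 *: x)| = (complex.Re `|f (`|x|^-1 *: x)|)%:C.
  by rewrite normc_def.
rewrite e /dual_norm lecR; apply: sup_upper_bound; first exact: normS_has_sup.
exists (`|x|^-1 *: x) => //.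
by rewrite normrZ normfV normr_id mulVf // gt_eqF.
Qed.

Lemma dual_norm_le f (k : R) :
  (forall x : X, `|x| <= 1 -> `|f x| <= k%:C) -> dual_norm f <= k%:C.
Proof.
move=> fk; rewrite /dual_norm lecR; apply: ge_sup; first by case: (normS_has_sup f).
by move=> r [x /fk fx e]; move: fx; rewrite e lecR.
Qed.

Lemma dual_norm_ge0 f : 0 <= dual_norm f.
Proof.
rewrite /dual_norm lecR; apply: sup_upper_bound; first exact: normS_has_sup.
by exists 0; rewrite ?normr0 ?ler01 // linear0 normr0.
Qed.

Lemma dual_norm_eq0 f : dual_norm f = 0 -> f = bl_zero _ _.
Proof.
move=> f0; apply: bl_eq => x; apply/eqP; rewrite -normr_le0.
by rewrite (le_trans (norm_le_dual_norm f x)) // f0 mul0r.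
Qed.

Let dual_norm_scale_le (c : R[i]) f :
  dual_norm (bl_scale c f) <= `|c| * dual_norm f.
Proof.
have e : `|c| * dual_norm f =
    (complex.Re `|c| * sup (normS f))%:C by rewrite rmorphM normc_def.
rewrite e; apply: dual_norm_le => x x1; rewrite -e /= normrM ler_wpM2l //.
rewrite (le_trans (norm_le_dual_norm f x)) // ler_piMr //.
exact: dual_norm_ge0.
Qed.

Lemma dual_norm_scale (c : R[i]) f :
  dual_norm (bl_scale c f) = `|c| * dual_norm f.
Proof.
apply/eqP; rewrite eq_le dual_norm_scale_le /=.
have [->|c0] := eqVneq c 0; first by rewrite normr0 mul0r dual_norm_ge0.
rewrite -ler_pdivlMl ?normr_gt0 // -normfV.
have {1}-> : f = bl_scale c^-1 (bl_scale c f).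
  by apply: bl_eq => x /=; rewrite scalerA mulVf // scale1r.
exact: dual_norm_scale_le.
Qed.

Lemma dual_spec_unique (x : X) : smooth -> exists! f, dual_spec x f.
Proof.
move=> sX; have [->|x0] := eqVneq x 0.
  exists (bl_zero _ _); split=> [|f [f0 _]]; last first.
    by apply/esym/dual_norm_eq0; rewrite f0 normr0.
  rewrite /dual_spec normr0 expr0n /=; split=> //.
  apply/eqP; rewrite eq_le dual_norm_ge0 andbT; apply: dual_norm_le => y _ /=.
  by rewrite normr0.
have nx0 : `|x| != 0 by rewrite normr_eq0.
have [|g [[g1 gx] gU]] := sX (`|x|^-1 *: x).
  by rewrite normrZ normfV normr_id mulVf.
have {}gx : g x = `|x|.
  move: gx; rewrite linearZ /= => /(congr1 ( *%R `|x|)).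
  by rewrite [`|x| * (_ *: _)]mulVKf // mulr1.
exists (bl_scale `|x| g); split=> [|f [nf fx]].
  by split; [rewrite dual_norm_scale g1 normr_id mulr1 | rewrite /= gx].
rewrite (gU (bl_scale `|x|^-1 f)).
  by apply: bl_eq => y /=; rewrite scalerA mulfV // scale1r.
split; first by rewrite dual_norm_scale nf normfV normr_id mulVf.
rewrite /= linearZ /= fx expr2 /GRing.scale /=.
by rewrite mulKf // mulVf.
Qed.

(* [get] returns an element of the set if it is nonempty and the zero
   functional otherwise; on a smooth space the set is a singleton. *)
Definition duality_map (x : X) : dual_space := get (dual_spec x).

Lemma duality_mapP (x : X) : smooth -> dual_spec x (duality_map x).
Proof.
by move=> /(dual_spec_unique x)[f [fx _]]; apply: getPex; exists f.
Qed.

Definition perp f : set X := [set y | f y = 0].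

Definition transpose (T : bounded_operators) f : dual_space := bl_comp f T.

Definition self_adjoint (T : bounded_operators) : Prop :=
  transpose T \o duality_map = duality_map \o T.

Definition eigenvector (T : bounded_operators) (a : R[i]) (x : X) : Prop :=
  x != 0 /\ T x = a *: x.

End Duality.

Arguments bounded_operators {R} X.
Arguments dual_space {R} X.
Arguments smooth {R} X.

(* Main.v *)
Require Import Defs.
From mathcomp Require Import all_boot all_order all_algebra.
From mathcomp Require Import complex.
From mathcomp Require Import all_classical all_reals all_analysis.
Import Order.TTheory GRing.Theory Num.Theory.
Import numFieldNormedType.Exports.
Local Open Scope classical_set_scope.
Local Open Scope ring_scope.
Local Open Scope complex_scope.

(** The duality map of a smooth space is conjugate-homogeneous,
    [J (a x) = conj a * J x], because the right-hand side has the norm and the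
    value at [a x] that single out [J (a x)] ([duality_mapZ]).  If [T x = a x],
    self-adjointness therefore reads [J x (T y) = conj a * J x y]; taking
    [y = x], where [J x x = |x|^2 <> 0], gives [a = conj a]
    ([self_adjoint_eigenvalue_real]).  Hence [J x] is an eigenvector of the
    transpose for the same eigenvalue [a] as [x].  For an eigenvector [y] of
    eigenvalue [b], computing [J x (T y)] in both ways gives
    [b * J x y = a * J x y], so [J x y = 0] as soon as [a <> b].  The argument
    is symmetric in the two eigenvectors, although [J x y] itself is not. *)

Section SelfAdjoint.
Context {R : realType} {X : completeNormedModType R[i]}.
Implicit Types (T : bounded_operators X) (x y : X) (a b : R[i]).

Lemma duality_map_unique x (f : dual_space X) :
  smooth X -> dual_spec x f -> duality_map x = f.
Proof.
move=> sX fx; have [g [_ gU]] := dual_spec_unique x sX.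
by rewrite -(gU _ fx) -(gU _ (duality_mapP x sX)).
Qed.

(** The conjugate is forced by the normalisation [J x x = |x|^2]:
    [conj a * J x (a x) = conj a * a * |x|^2 = |a x|^2]. *)
Lemma duality_mapZ a x :
  smooth X -> duality_map (a *: x) = bl_scale (Num.conj a) (duality_map x).
Proof.
move=> sX; have [Jnorm Jxx] := duality_mapP x sX.
apply: duality_map_unique => //; split.
  by rewrite dual_norm_scale Jnorm norm_conjC normrZ.
rewrite /= linearZ /= Jxx normrZ exprMn normCK /GRing.scale /=.
by rewrite mulrCA mulrA.
Qed.

Lemma self_adjointE T x y :
  self_adjoint T -> duality_map x (T y) = duality_map (T x) y.
Proof. by move=> /(congr1 (fun F => bl_fun (F x) y)). Qed.

(** As for Hermitian operators, with [J x] in place of the inner product: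
    [a * |x|^2 = J x (T x) = J (T x) x = conj a * |x|^2]. *)
Lemma self_adjoint_eigenvalue_real T a x :
  smooth X -> self_adjoint T -> eigenvector T a x -> Num.conj a = a.
Proof.
move=> sX sT [x0 Tx]; have [_ Jxx] := duality_mapP x sX.
have := self_adjointE T x x sT.
rewrite Tx duality_mapZ // linearZ /= Jxx /GRing.scale /=.
have nx0 : `|x| ^+ 2 != 0 by rewrite expf_neq0 // normr_eq0.
by move/(mulIf nx0).
Qed.

Lemma eigenvector_perp T a b x y :
  smooth X -> self_adjoint T -> eigenvector T a x -> eigenvector T b y ->
  a <> b -> y \in perp (duality_map x).
Proof.
move=> sX sT eTx [_ Ty] ab; rewrite inE /perp /=.
have := self_adjointE T x y sT.
rewrite Ty eTx.2 duality_mapZ // (self_adjoint_eigenvalue_real T a x) //.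
rewrite linearZ /= /GRing.scale /=.
by have [//|Jxy0 /(mulIf Jxy0)/esym] := eqVneq (duality_map x y) 0.
Qed.

End SelfAdjoint.

Theorem proposition13 (R : realType) (X : completeNormedModType R[i])
    (T : bounded_operators X) (x1 x2 : X) (a1 a2 : R[i]) :
  smooth X ->
  self_adjoint T ->
  eigenvector T a1 x1 ->
  eigenvector T a2 x2 ->
  a1 <> a2 ->
  x2 \in perp (duality_map x1) /\ x1 \in perp (duality_map x2).
Proof.
move=> sX sT e1 e2 a12; split; first exact: (eigenvector_perp T a1 a2).
by apply: (eigenvector_perp T a2 a1) => //; exact/nesym.
Qed.
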